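(* Let $n$ be an odd integer, $q=2^n$, and let $i$ be a positive integer with $\gcd(i,n)=1$. Let $s=2^{2i}-2^i+1$ and \[B=\mathrm{GF}(q)\setminus\left\{\big((x+1)^s+x^s+1\big)^{\frac{1}{2^i+1}}: x\in\mathrm{GF}(q)\right\}.\] Then the incidence structure $(\mathrm{GF}(q),\mathrm{GA}_1(q)(B))$ is a $3$-$\left(q,\frac q2,\frac{q(q-4)}{8}\right)$ design.
   Context: For an integer $e$ with $\gcd(e,q-1)=1$, $\frac1e$ as an exponent denotes the inverse of $e$ modulo $q-1$ (here $\gcd(2^i+1,q-1)=1$). $\mathrm{GA}_1(q)$ is the group of permutations $x\mapsto ax+b$ of $\mathrm{GF}(q)$ with $(a,b)\in\mathrm{GF}(q)^*\times\mathrm{GF}(q)$; $\mathrm{GA}_1(q)(B)=\{\pi(B):\pi\in\mathrm{GA}_1(q)\}$, with incidence given by membership. A $3$-$(v,k,\lambda)$ design is a pair $(\mathcal P,\mathcal B)$ with $|\mathcal P|=v$, $\mathcal B$ a set of $k$-subsets of $\mathcal P$, such that every $3$-subset of $\mathcal P$ is contained in exactly $\lambda$ members of $\mathcal B$. *)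

(* Defs.v *)
From HB Require Import structures.
From mathcomp Require Import all_boot all_order all_algebra all_field.
Set Implicit Arguments. Unset Strict Implicit. Unset Printing Implicit Defensive.
Import GRing.Theory.
Local Open Scope ring_scope.

(* 1/e as an exponent: the inverse d of e modulo m = q-1, chosen in 1..m.
   (Exists whenever gcd(e,m)=1 and m>=1.) *)
Definition inv_exp (e m : nat) : nat :=
  if [pick d : 'I_m.+1 | (0 < d)%N && ((d * e) %% m == 1 %% m)%N] is Some d
  then nat_of_ord d else 0%N.

Definition GA1_orbit (F : finFieldType) (B : {set F}) : {set {set F}} :=
  [set [set p.1 * x + p.2 | x in B] | p in [set p : F * F | p.1 != 0]].

Definition is_3_design (T : finType) (blocks : {set {set T}}) (v k lam : nat) : Prop :=
  [/\ #|T| = v,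
      (forall Bl, Bl \in blocks -> #|Bl| = k) &
      (forall S : {set T}, #|S| = 3%N -> #|[set Bl in blocks | S \subset Bl]| = lam)].

(* Main.v *)
Require Import Defs.
From Stdlib Require Import PArith NArith Ring.
From HB Require Import structures.
From mathcomp Require Import all_boot all_order all_algebra all_field.
From mathcomp Require Import zify.
Set Implicit Arguments. Unset Strict Implicit. Unset Printing Implicit Defensive.
Import Order.TTheory GRing.Theory Num.Theory.
Local Open Scope ring_scope.

(** Write sigma x = x^(2^i), chi = (-1)^Tr, and let f be -1 on B and 1 off B.
  Substituting x = u^(2^i+1), x + 1 = v^(2^i+1) and c = u + v, the elements off B become
  z = (c + sigma^2 c) / sigma c with Tr (1 / (c sigma c)) = 1, i.e. those for which the
  sigma-linear equation sigma^2 c + z sigma c + c = 0 has exactly one nonzero solution.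

  Let Phi u = \sum_x chi (x^3 + u^(1/3) x).  The matrix Phi (x y) satisfies, together with
  the diagonal matrices chi (b x), the relations of the standard generators of SL_2 (F)
  (in the cuspidal representation attached to a cubic character): this is [sum_cbrt_sumM]
  and [cbrt_sum_braid], which reduce to completing a cube under the trace.  These relations
  alone give q^-1 \sum_a chi (a z) Phi (a sigma a) = -chi (1 / (c sigma c)); the left side is,
  up to sign, the trace of sigma composed with the matrix sending (c, sigma c) to
  (sigma c, sigma^2 c), which fixes a vector and so is sigma-conjugate to a unipotent.
  Hence the sum equals f z off B; since the fibres of the Kasami difference map have at most
  two elements, Parseval forces it to be f everywhere.  So W a = Phi (a sigma a) is the
  Fourier transform of f (Dillon and Dobbertin).

  The design property amounts to \sum_w W (t w) W (r w) W ((t + r) w) = 0, which is an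
  exponential sum over the binary cubic x^3 / (t sigma t) + y^3 / (r sigma r)
  + (x + y)^3 / ((t + r) sigma (t + r)).  Its Hessian is the product of r x + t y and
  sigma r x + sigma t y, so in these coordinates the cubic is diagonal and the sum splits
  into two sums of chi over all cubes, both zero. *)

(** * Inverse exponents and the coprimality behind them *)

Lemma inv_expP e m : (0 < m)%N -> coprime e m ->
  (0 < inv_exp e m)%N /\ inv_exp e m * e = 1 %[mod m].
Proof.
move=> m_gt0 co_em; rewrite /inv_exp.
case: pickP => [d /andP[d_gt0 /eqP de] // | no].
(* For [m = 1] every residue is 0, so the positive witness is [m] itself. *)
have [m1 | m_neq1] := eqVneq m 1%N.
  by have := no ord_max; rewrite /= m_gt0 m1 !modn1.
have m_gt1 : (1 < m)%N by rewrite ltn_neqAle eq_sym m_neq1.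
have e_gt0 : (0 < e)%N by case: e co_em {no} => //; rewrite /coprime gcd0n (negPf m_neq1).
have [u v uv _] := egcdnP m e_gt0.
have ue : u * e = 1 %[mod m] by rewrite uv (eqP co_em) modnMDl.
have ltu : (u %% m < m.+1)%N by rewrite ltnW // ltnS ltn_pmod.
have := no (Ordinal ltu); rewrite /= modnMml ue eqxx andbT lt0n => /negbFE/eqP u0.
by move: ue; rewrite -modnMml u0 mod0n modn_small.
Qed.

(** Modulo a common divisor the order of 2 divides both n and 2 i. These are coprime because n is
    odd, so 2 = 1 there and the divisor is 1. *)
Lemma coprime_gold i n : odd n -> coprime i n -> coprime (2 ^ i + 1) (2 ^ n - 1).
Proof.
move=> odd_n co_in; set g := gcdn (2 ^ i + 1) (2 ^ n - 1).
have n2 : 2 ^ n = 1 %[mod g].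
  by apply/eqP; rewrite eqn_mod_dvd ?expn_gt0 // dvdn_gcdr.
have i2 : 2 ^ (2 * i) = 1 %[mod g].
  apply/eqP; rewrite eqn_mod_dvd ?expn_gt0 //.
  have -> : (2 ^ (2 * i) - 1 = (2 ^ i - 1) * (2 ^ i + 1))%N.
    by rewrite -subn_sqr exp1n mulnC expnM.
  by rewrite dvdn_mull // dvdn_gcdl.
have pow1 a m : 2 ^ a = 1 %[mod g] -> 2 ^ (m * a) = 1 %[mod g].
  by move=> a2; rewrite mulnC expnM -modnXm a2 modnXm exp1n.
have co2 : coprime n (2 * i) by rewrite coprimeMr coprimen2 odd_n coprime_sym.
have n_gt0 : (0 < n)%N by case: (n) odd_n.
have [u v uv _] := egcdnP (2 * i) n_gt0.
have := pow1 _ u n2; rewrite uv (eqP co2) addn1 expnS -modnMmr (pow1 _ _ i2).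
rewrite modnMmr muln1 => /eqP; rewrite eqn_mod_dvd //.
by rewrite dvdn1.
Qed.

(** * Characteristic two *)

Ltac nat_cst t :=
  match t with
  | O => constr:(N0)
  | S ?n => match nat_cst n with
            | InitialRing.NotConstant => constr:(InitialRing.NotConstant)
            | ?m => let r := eval compute in (N.succ m) in constr:(r)
            end
  | _ => constr:(InitialRing.NotConstant)
  end.

Section Kasami.
Variables (F : finFieldType) (n : nat).
Hypotheses (odd_n : odd n) (cardF : #|F| = (2 ^ n)%N).
Implicit Types (x y z a b c k u v w G : F) (i j : nat).

Let n_gt0 : (0 < n)%N.
Proof. by case: n odd_n. Qed.

Let pchar2 : 2%N \in [pchar F].
Proof. exact: (card_finPcharP cardF). Qed.

Let two0 : 2%:R = 0 :> F.
Proof. by rewrite pcharf0. Qed.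

Let oppF x : - x = x.
Proof. exact: oppr_pchar2. Qed.

Let addFF x : x + x = 0.
Proof. exact: addrr_pchar2. Qed.

Lemma addF_eq0 x y : (x + y == 0) = (x == y).
Proof. by rewrite -[y in LHS]oppF subr_eq0. Qed.

(* A [ring] tactic with coefficients in the field with two elements. *)
Definition addF (x y : F) : F := x + y.
Definition mulF (x y : F) : F := x * y.
Definition expF (x : F) (n : nat) : F := x ^+ n.
Definition invF x : F := x^-1.
Definition boolF (b : bool) : F := if b then 1 else 0.

Lemma char2_ring_theory :
  @ring_theory (FinRing.Field.sort F) 0 1 addF mulF addF id eq.
Proof.
by split=> //; [exact: add0r | exact: addrC | exact: addrA | exact: mul1r
  | exact: mulrC | exact: mulrA | exact: mulrDl].
Qed.

Lemma char2_ring_morph :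
  @ring_morph (FinRing.Field.sort F) 0 1 addF mulF addF id eq
    bool false true xorb andb xorb id Bool.eqb boolF.
Proof.
split=> //; rewrite /addF /mulF.
- by move=> [] []; rewrite /= ?addr0 ?add0r // -[1 + 1]mulr2n two0.
- by move=> [] []; rewrite /= ?addr0 ?add0r // -[1 + 1]mulr2n two0.
- by move=> [] []; rewrite /= ?mulr0 ?mulr1.
- by move=> [] [].
Qed.

Lemma char2_power_theory :
  @power_theory (FinRing.Field.sort F) 1 mulF eq nat N.to_nat expF.
Proof.
split=> r [|p] //=; elim/Pos.peano_ind: p => // p IH.
rewrite Pnat.Pos2Nat.inj_succ /expF exprS -[r ^+ Pos.to_nat p]/(expF _ _) IH.
by rewrite pow_pos_succ //; exact: mulrA.
Qed.

Ltac bool_cst t :=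
  match t with
  | 0 => constr:(false)
  | 1 => constr:(true)
  | _ => constr:(InitialRing.NotConstant)
  end.

Add Ring char2_ring : char2_ring_theory
  (morphism char2_ring_morph, constants [bool_cst], power_tac char2_power_theory [nat_cst]).

(* The instance arguments of the GRing operations are not canonical after rewriting,
   and [ring] recognizes operations only syntactically. *)
Ltac fold_ops t :=
  lazymatch t with
  | @GRing.add _ ?a ?b => let a := fold_ops a in let b := fold_ops b in constr:(addF a b)
  | @GRing.mul _ ?a ?b => let a := fold_ops a in let b := fold_ops b in constr:(mulF a b)
  | @GRing.exp _ ?a ?m => let a := fold_ops a in constr:(expF a m)
  | @GRing.inv _ ?a => let a := fold_ops a in constr:(invF a)
  | @GRing.one _ => constr:(1 : F)
  | @GRing.zero _ => constr:(0 : F)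
  | _ => constr:(t : F)
  end.

Ltac ring2 :=
  lazymatch goal with |- ?l = ?r =>
    let l := fold_ops l in let r := fold_ops r in change (@eq F l r); ring
  end.

Lemma frobD i x y : (x + y) ^+ (2 ^ i) = x ^+ (2 ^ i) + y ^+ (2 ^ i).
Proof. by rewrite exprDn_pchar // pnatX pnatE // pchar2. Qed.

Lemma frob_inj i : injective (fun x => x ^+ (2 ^ i)).
Proof.
move=> x y /= /eqP; rewrite -addF_eq0 -frobD expf_eq0 addF_eq0.
by case/andP=> _ /eqP.
Qed.

Lemma frob_period x : x ^+ (2 ^ n) = x.
Proof. by rewrite -cardF expf_card. Qed.

Lemma sqr_fix x : x ^+ 2 = x -> x = 0 \/ x = 1.
Proof.
move=> x2; have /eqP : x * (x - 1) = 0 by rewrite mulrBr mulr1 -expr2 x2 subrr.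
by rewrite mulf_eq0 subr_eq0 => /orP[] /eqP; [left | right].
Qed.

Lemma frob_fixM i m x : x ^+ (2 ^ i) = x -> x ^+ (2 ^ (m * i)) = x.
Proof.
move=> xi; elim: m => [|m IH]; first by rewrite expr1.
by rewrite mulSn expnD exprM xi IH.
Qed.

(** By Bezout some iterate of x -> x^(2^i) is squaring, which fixes only 0 and 1. *)
Lemma frob_fix i x : coprime i n -> x ^+ (2 ^ i) = x -> x = 0 \/ x = 1.
Proof.
move=> co_in xi; case: (posnP i) => [i0|i_gt0].
  have n1 : n = 1%N by move: co_in; rewrite i0 /coprime gcd0n => /eqP.
  have := frob_period x; rewrite n1 expn1.
  exact: sqr_fix.
have [u v uv _] := egcdnP n i_gt0.
have : x ^+ (2 ^ (u * i)) = x by apply: frob_fixM.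
rewrite uv (eqP co_in) expnD exprM frob_fixM ?frob_period // expn1.
exact: sqr_fix.
Qed.

(** * The additive character *)

Definition ftrace x := \sum_(j < n) x ^+ (2 ^ j).

Lemma ftraceD x y : ftrace (x + y) = ftrace x + ftrace y.
Proof. by rewrite -big_split /=; apply: eq_bigr => j _; rewrite frobD. Qed.

Lemma ftrace_sqr x : ftrace (x ^+ 2) = ftrace x.
Proof.
rewrite /ftrace; case: n n_gt0 frob_period => // m _ per.
rewrite big_ord_recr big_ord_recl /= expr1 -exprM -expnS per addrC.
by congr (_ + _); apply: eq_bigr => j _; rewrite -exprM -expnS.
Qed.

Lemma ftrace_idem x : ftrace x ^+ 2 = ftrace x.
Proof.
rewrite -[RHS]ftrace_sqr /ftrace.
rewrite (big_morph (fun x => x ^+ 2) (frobD 1) (expr0n _ 2)).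
by apply: eq_bigr => j _; rewrite -!exprM mulnC.
Qed.

Lemma ftrace01 x : ftrace x = 0 \/ ftrace x = 1.
Proof. exact/sqr_fix/ftrace_idem. Qed.

Lemma ftrace1 : ftrace 1 = 1.
Proof.
rewrite /ftrace (eq_bigr (fun _ => 1)) => [|j _]; last by rewrite expr1n.
rewrite sumr_const card_ord -(odd_double_half n) odd_n mulrnDr -muln2 mulnC.
by rewrite mulrnA two0 mul0rn addr0.
Qed.

Definition chi x : int := if ftrace x == 0 then 1 else -1.

Lemma chi0 : chi 0 = 1.
Proof.
rewrite /chi /ftrace big1 ?eqxx // => j _.
by rewrite expr0n expn_eq0.
Qed.

Lemma chi1 : chi 1 = -1.
Proof. by rewrite /chi ftrace1 oner_eq0. Qed.

Lemma chiD x y : chi (x + y) = chi x * chi y.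
Proof.
rewrite /chi ftraceD.
case: (ftrace01 x) => ->; case: (ftrace01 y) => ->;
by rewrite ?addr0 ?add0r ?addFF ?oner_eq0 ?eqxx.
Qed.

Lemma chi_sqr x : chi (x ^+ 2) = chi x.
Proof. by rewrite /chi ftrace_sqr. Qed.

Lemma chi_frob i x : chi (x ^+ (2 ^ i)) = chi x.
Proof.
elim: i => [|i IH]; first by rewrite expr1.
by rewrite expnS mulnC exprM chi_sqr IH.
Qed.

Lemma chiK x : chi x * chi x = 1.
Proof. by rewrite -chiD addFF chi0. Qed.

Lemma chi_pm x : chi x = 1 \/ chi x = -1.
Proof. by rewrite /chi; case: ifP; [left|right]. Qed.

(** An element w^2 + w has trace zero; the substitutions in the cubic sums are checked by exhibiting
    such a [w]. *)
Lemma eq_chi w x y : x + y = w ^+ 2 + w -> chi x = chi y.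
Proof.
move=> xy; have: chi (x + y) = 1 by rewrite xy chiD chi_sqr chiK.
by rewrite chiD => h; rewrite -[RHS]mul1r -h -mulrA chiK mulr1.
Qed.

Local Notation q := (#|F|%:R : int).

Lemma q_neq0 : q != 0.
Proof. by rewrite pnatr_eq0 cardF expn_eq0. Qed.

Lemma sum_chi a : \sum_x chi (x * a) = q * (a == 0)%:R.
Proof.
have [->|a0] := eqVneq a 0.
  rewrite (eq_bigr (fun _ => 1)) => [|x _]; last by rewrite mulr0 chi0.
  by rewrite sumr_const cardT mulr1 -cardE.
rewrite mulr0; set s := (X in X = _).
suff : s = - s by lia.
rewrite {1}/s (reindex_inj (addrI a^-1)) /= -sumrN.
by apply: eq_bigr => x _; rewrite mulrDl mulVf // chiD chi1 mulN1r.
Qed.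

Lemma exp_inv_expK e x : (0 < e)%N -> coprime e (2 ^ n - 1) ->
  (x ^+ e) ^+ inv_exp e (2 ^ n - 1) = x.
Proof.
move=> e_gt0 co_e.
have m_gt0 : (0 < 2 ^ n - 1)%N by rewrite subn_gt0 -{1}(expn0 2) ltn_exp2l.
have [d_gt0 de] := inv_expP m_gt0 co_e; set d := inv_exp _ _ in d_gt0 de *.
(* At 0 the identity needs a positive inverse exponent, which [inv_expP] provides. *)
have [->|x0] := eqVneq x 0.
  by rewrite -exprM expr0n muln_eq0 !gtn_eqF.
have xm : x ^+ (2 ^ n - 1) = 1.
  apply: (mulfI x0); rewrite mulr1 -exprS subn1 prednK ?expn_gt0 //.
  exact: frob_period.
have red (k : nat) : x ^+ k = x ^+ (k %% (2 ^ n - 1)).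
  by rewrite {1}(divn_eq k (2 ^ n - 1)) exprD mulnC exprM xm expr1n mul1r.
by rewrite -exprM mulnC red de -red expr1.
Qed.

Definition cbrt x := x ^+ inv_exp 3 (2 ^ n - 1).

Lemma coprime3 : coprime 3 (2 ^ n - 1).
Proof. by apply: (@coprime_gold 1) => //; rewrite coprime1n. Qed.

Lemma cubeK x : cbrt (x ^+ 3) = x.
Proof. exact: exp_inv_expK coprime3. Qed.

Lemma cbrtK x : cbrt x ^+ 3 = x.
Proof. by rewrite /cbrt exprAC; exact: cubeK. Qed.

Lemma cbrtM x y : cbrt (x * y) = cbrt x * cbrt y.
Proof. exact: exprMn. Qed.

Lemma cbrtX x m : cbrt (x ^+ m) = cbrt x ^+ m.
Proof. exact: exprAC. Qed.

Lemma cube_inj : injective (fun x => x ^+ 3).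
Proof. exact: can_inj cubeK. Qed.

Lemma cbrt_inj : injective cbrt.
Proof. exact: (can_inj (g := fun x => x ^+ 3) cbrtK). Qed.

Lemma cbrt0 : cbrt 0 = 0.
Proof. by apply: cube_inj; rewrite /= cbrtK expr0n. Qed.

Lemma cbrt_eq0 x : (cbrt x == 0) = (x == 0).
Proof. by rewrite -{1}cbrt0 (inj_eq cbrt_inj). Qed.

Lemma sum_chi_cube a : a != 0 -> \sum_x chi (x ^+ 3 * a) = 0.
Proof.
move=> a0; rewrite -(reindex_inj cube_inj (F := fun x => chi (x * a)) (P := predT)) /=.
by rewrite sum_chi (negPf a0) mulr0.
Qed.

(** * Cubic exponential sums *)

Definition cubic_sum k : int := \sum_x chi (x ^+ 3 + k * x).
Local Notation S := cubic_sum.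

Lemma cubic_sum0 : S 0 = 0.
Proof.
rewrite -(sum_chi_cube (oner_neq0 F)).
by apply: eq_bigr => x _; rewrite mul0r addr0 mulr1.
Qed.

Lemma cubic_sum_frob i k : S (k ^+ (2 ^ i)) = S k.
Proof.
rewrite /S (reindex_inj (@frob_inj i)); apply: eq_bigr => x _ /=.
by rewrite exprAC -exprMn -frobD chi_frob.
Qed.

(** The sum over k confines (x, y) to the line a x = b y. There the exponent is a constant times a
    cube, and cubing is bijective. *)
Lemma sum_cubic_sumM a b : a != 0 -> b != 0 ->
  \sum_k S (a * k) * S (b * k) = q ^+ 2 * (a == b)%:R.
Proof.
move=> a0 b0.
transitivity (\sum_x \sum_y chi (x ^+ 3 + y ^+ 3) * (q * (a * x + b * y == 0)%:R)).
  under eq_bigr => k _ do rewrite big_distrlr /=.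
  rewrite exchange_big; apply: eq_bigr => x _ /=.
  rewrite exchange_big; apply: eq_bigr => y _ /=.
  rewrite -sum_chi mulr_sumr; apply: eq_bigr => k _; rewrite -!chiD.
  by congr chi; ring2.
transitivity (\sum_x q * chi (x ^+ 3 * (a ^+ 3 + b ^+ 3))).
  rewrite (reindex_inj (mulfI b0)); apply: eq_bigr => x _ /=.
  rewrite (bigD1 (a * x)) //= big1 => [|y yx].
    rewrite addr0 [a * (b * x)]mulrCA addFF eqxx mulr1 mulrC; congr (_ * chi _).
    ring2.
  rewrite [a * (b * x)]mulrCA -mulrDr mulf_eq0 (negPf b0) addF_eq0 eq_sym (negPf yx).
  by rewrite !mulr0.
rewrite -mulr_sumr expr2 -mulrA; congr (_ * _).
rewrite -(reindex_inj cube_inj (F := fun x => chi (x * _)) (P := predT)) /=.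
by rewrite sum_chi addF_eq0 (inj_eq cube_inj).
Qed.

Lemma sqrt_ex x : exists y, x = y ^+ 2.
Proof.
exists (x ^+ (2 ^ n.-1)); rewrite -exprM mulnC -expnS prednK //.
by rewrite frob_period.
Qed.

Lemma coprime2 : coprime 2 n.
Proof. by rewrite coprime2n. Qed.

Lemma frob2_fix x : x ^+ 4 = x -> x = 0 \/ x = 1.
Proof. exact: frob_fix coprime2. Qed.

(* The change of variable v completes the cube: the exponents on both sides of
   [cubic_sum_braid] differ by the trace-zero element w^2 + w. *)
Lemma braid_trace (r g e f : F) : e * f = 1 ->
  let c := (r ^+ 4 + r) * f ^+ 2 in
  let v := r ^+ 3 * f ^+ 2 + e + f ^+ 2 in
  let a := (g + e) ^+ 2 in let b := g ^+ 2 in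
  let u := r ^+ 3 * f ^+ 2 in
  let w := r ^+ 3 + e * u ^+ 2 + g * e * u + f ^+ 3 + g * f + e ^+ 3
           + g ^+ 2 * e + g * e ^+ 2 in
  ((r ^+ 2) ^+ 3 + c ^+ 3 + c * b * r ^+ 2)
  + (1 + ((a ^+ 3 + b ^+ 3) + (v ^+ 3 + g * (g + e) * v))) = w ^+ 2 + w.
Proof.
move=> ef /=; apply/eqP; rewrite -addF_eq0; apply/eqP.
(* the cofactor is the quotient, modulo 2, of the polynomial identity by e f + 1 *)
transitivity ((e * f + 1) * (1 + e * f + r ^+ 3 * (1 + e * f) + g * f + f ^+ 3
    + r ^+ 6 * g ^+ 2 * f ^+ 2 * (1 + e * f) + r ^+ 12 * f ^+ 6 * (1 + e * f))).
  ring2.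
by rewrite ef addFF mul0r.
Qed.

(** Put y = x + p in the product. Up to trace zero the exponent is affine in x^2, so summing over x
    leaves the condition p + p^4 = (c (a + b))^2. For a = b only p = 0 and p = 1 remain; otherwise p
    determines c, and a sum over one variable is left. *)
Lemma cubic_sum_braid a b :
  \sum_c chi (c ^+ 3) * (S (a * c) * S (b * c))
  = - (q * chi (a ^+ 3 + b ^+ 3) * S (a * b)).
Proof.
transitivity (\sum_c \sum_p q * (chi (p ^+ 3 + c ^+ 3 + c * b * p)
    * (p + p ^+ 4 + (c * (a + b)) ^+ 2 == 0)%:R)).
  apply: eq_bigr => c _; rewrite big_distrlr mulr_sumr /=.
  transitivity (\sum_x \sum_p chi (p ^+ 3 + c ^+ 3 + c * b * p)
       * chi (x ^+ 2 * (p + p ^+ 4 + (c * (a + b)) ^+ 2))).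
    apply: eq_bigr => x _; rewrite mulr_sumr (reindex_inj (addrI x)) /=.
    apply: eq_bigr => p _; rewrite -!chiD.
    apply: (@eq_chi (x * p ^+ 2 + x * c * (a + b))); ring2.
  rewrite exchange_big; apply: eq_bigr => p _ /=.
  rewrite -mulr_sumr mulrCA; congr (_ * _).
  by rewrite -sum_chi [RHS](reindex_inj (@frob_inj 1)).
have [ab | ab] := eqVneq a b.
  rewrite ab (addFF (b ^+ 3)) chi0 mulr1 -[b * b]expr2 (cubic_sum_frob 1).
  transitivity (\sum_c q * (chi (c ^+ 3 * 1) + chi (1 + (c ^+ 3 + b * c)))).
    apply: eq_bigr => c _; rewrite (bigD1 0) // (bigD1 1) ?oner_eq0 //= big1 => [|p].
      rewrite !expr0n !expr1n !addFF !mulr0 !expr0n !addr0 !add0r eqxx !mulr1.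
      by rewrite mulrDr [b * c]mulrC addrA.
    move=> /andP[p0 p1]; rewrite addFF mulr0 expr0n addr0 addF_eq0.
    case: eqP => [e | _]; last by rewrite !mulr0.
    by case: (frob2_fix (esym e)) p0 p1 => ->; rewrite eqxx.
  rewrite -mulr_sumr big_split /= sum_chi_cube ?oner_neq0 // add0r -mulrN.
  congr (_ * _); rewrite -sumrN; apply: eq_bigr => c _.
  by rewrite chiD chi1 mulN1r.
(* With a + b = d^2 and p = r^2, the condition reads c = (r^4 + r) / d^2, the [c0] below. *)
have [d dE] := sqrt_ex (a + b); have [g gE] := sqrt_ex b.
have d0 : d != 0.
  by apply: contra_neq ab => d0; apply/eqP; rewrite -addF_eq0 dE d0 expr0n.
have aE : a = (g + d) ^+ 2 by rewrite -[LHS]addr0 -(addFF b) addrA dE gE; ring2.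
rewrite exchange_big (reindex_inj (@frob_inj 1)) /= expn1.
transitivity (\sum_r q * chi ((r ^+ 2) ^+ 3 + ((r ^+ 4 + r) * d^-1 ^+ 2) ^+ 3
   + ((r ^+ 4 + r) * d^-1 ^+ 2) * b * r ^+ 2)).
  apply: eq_bigr => r _; set c0 := (r ^+ 4 + r) * _.
  have c0E : c0 * (a + b) = r ^+ 4 + r by rewrite dE -mulrA -exprMn mulVf // expr1n mulr1.
  have condE c : r ^+ 2 + (r ^+ 2) ^+ 4 + (c * (a + b)) ^+ 2
      = ((c + c0) * (a + b)) ^+ 2.
    by rewrite [(c + c0) * _]mulrDl c0E; ring2.
  rewrite (bigD1 c0) //= big1 => [|c cc0].
    by rewrite condE addFF mul0r expr0n eqxx mulr1 addr0.
  by rewrite condE expf_eq0 mulf_eq0 !addF_eq0 (negPf cc0) (negPf ab) !mulr0.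
have -> : a * b = (g * (g + d)) ^+ 2 by rewrite aE gE; ring2.
rewrite (cubic_sum_frob 1) -mulr_sumr -mulrA -mulrN; congr (_ * _).
have shift_inj : injective (fun r => r ^+ 3 * d^-1 ^+ 2 + d + d^-1 ^+ 2).
  move=> x y /addIr/addIr/(mulIf _) h; apply: cube_inj; apply: h.
  by rewrite expf_neq0 // invr_eq0.
rewrite mulr_sumr -sumrN [RHS](reindex_inj shift_inj); apply: eq_bigr => r _ /=.
rewrite -mulN1r -chi1 -!chiD.
apply: eq_chi; rewrite aE gE; exact: (braid_trace r g (mulfV d0)).
Qed.

Definition cbrt_sum u : int := S (cbrt u).
Local Notation Phi := cbrt_sum.

Lemma cbrt_sum0 : Phi 0 = 0.
Proof. by rewrite /Phi cbrt0 cubic_sum0. Qed.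

Lemma cbrt_sum_frob i u : Phi (u ^+ (2 ^ i)) = Phi u.
Proof. by rewrite /Phi cbrtX cubic_sum_frob. Qed.

Lemma sum_cbrt_sumM a b : a != 0 -> b != 0 ->
  \sum_y Phi (a * y) * Phi (b * y) = q ^+ 2 * (a == b)%:R.
Proof.
move=> a0 b0; rewrite -(inj_eq cbrt_inj) -sum_cubic_sumM ?cbrt_eq0 //.
rewrite [RHS](reindex_inj cbrt_inj); apply: eq_bigr => y _ /=.
by rewrite /Phi !cbrtM.
Qed.

Lemma cbrt_sum_braid a b :
  \sum_v chi v * (Phi (a * v) * Phi (b * v)) = - (q * chi (a + b) * Phi (a * b)).
Proof.
rewrite /Phi -{2}(cbrtK a) -{2}(cbrtK b) cbrtM -cubic_sum_braid.
rewrite [LHS](reindex_inj cube_inj); apply: eq_bigr => c _ /=.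
by rewrite (cbrtM a) (cbrtM b) cubeK.
Qed.

(** Rescaling moves a into the cubic coefficient, so that the three factors in [sum_cubic_sum3]
    share the linear coefficient k. *)
Lemma cubic_sumE a k : a != 0 -> S (a * k) = \sum_x chi (x ^+ 3 * (a ^+ 3)^-1 + k * x).
Proof.
move=> a0; rewrite [RHS](reindex_inj (mulfI a0)); apply: eq_bigr => x _ /=.
rewrite exprMn [a ^+ 3 * _ / _]mulrAC mulfV ?expf_neq0 // mul1r; congr chi; ring2.
Qed.

Lemma sum_cubic_sum3 a b c : a != 0 -> b != 0 -> c != 0 ->
  \sum_k S (a * k) * (S (b * k) * S (c * k)) =
  q * \sum_x \sum_y chi (x ^+ 3 * (a ^+ 3)^-1 + y ^+ 3 * (b ^+ 3)^-1
                        + (x + y) ^+ 3 * (c ^+ 3)^-1).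
Proof.
move=> a0 b0 c0; set A := (a ^+ 3)^-1; set B := (b ^+ 3)^-1; set C := (c ^+ 3)^-1.
transitivity (\sum_k \sum_x \sum_y \sum_z
    chi (x ^+ 3 * A + y ^+ 3 * B + z ^+ 3 * C) * chi (k * (x + y + z))).
  apply: eq_bigr => k _; rewrite !cubic_sumE // mulr_suml; apply: eq_bigr => x _.
  rewrite big_distrlr mulr_sumr; apply: eq_bigr => y _ /=.
  rewrite mulr_sumr; apply: eq_bigr => z _; rewrite -/A -/B -/C -!chiD; congr chi; ring2.
rewrite exchange_big mulr_sumr; apply: eq_bigr => x _ /=.
rewrite exchange_big mulr_sumr; apply: eq_bigr => y _ /=.
rewrite exchange_big /= (bigD1 (x + y)) //= [X in _ + X]big1 => [|z zxy].
  by rewrite -mulr_sumr sum_chi addFF eqxx mulr1 addr0 mulrC.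
by rewrite -mulr_sumr sum_chi addF_eq0 eq_sym (negPf zxy) !mulr0.
Qed.

(** * The Walsh transform *)

Section Gold.
Variable i : nat.
Implicit Types (t r T R : F).
Hypothesis co_in : coprime i n.
Local Notation sigma x := (x ^+ (2 ^ i)).

Lemma sigma_fix x : sigma x = x -> x = 0 \/ x = 1.
Proof. exact: frob_fix. Qed.

Lemma sigma_inj : injective (fun x => sigma x).
Proof. exact: frob_inj. Qed.

Lemma gold_inj : injective (fun x => x * sigma x).
Proof.
move=> x y /=; rewrite -!exprS -addn1.
move/(congr1 (fun z => z ^+ inv_exp (2 ^ i + 1) (2 ^ n - 1))).
by rewrite !exp_inv_expK ?addn1 // -addn1 coprime_gold.
Qed.

Lemma sigma_eqM t u : t != 0 -> t * sigma u = u * sigma t -> u = 0 \/ u = t.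
Proof.
move=> t0 tu; have st0 : sigma t != 0 by rewrite expf_neq0.
have : sigma (u / t) = u / t.
  rewrite expr_div_n; apply: (mulIf st0); rewrite mulfVK //.
  by apply: (mulfI t0); rewrite tu [RHS]mulrA [t * (u / t)]mulrC mulfVK.
case/sigma_fix => /eqP.
  by rewrite mulf_eq0 invr_eq0 (negPf t0) orbF => /eqP; left.
by rewrite -subr_eq0 -(mulfV t0) -mulrBl mulf_eq0 invr_eq0 (negPf t0) orbF subr_eq0 => /eqP; right.
Qed.

Definition walsh a := Phi (a * sigma a).
Local Notation W := walsh.

Lemma walsh0 : W 0 = 0.
Proof. by rewrite /W mul0r cbrt_sum0. Qed.

(* After a = y sigma G, the braid relation turns the sum into a double sum in which the
   orthogonality relation leaves only v = 1 / (G sigma G). *)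
Lemma sum_walsh_kernel G : G != 0 ->
  \sum_a chi (a * ((G + sigma (sigma G)) / sigma G)) * W a
  = - (q * chi (G * sigma G)^-1).
Proof.
move=> G0; have sG0 : sigma G != 0 by rewrite expf_neq0.
have ssG0 : sigma (sigma G) != 0 by rewrite expf_neq0.
have Nq0 : - q != 0 by rewrite oppr_eq0 q_neq0.
apply: (mulfI Nq0); rewrite (reindex_inj (mulfI sG0)) mulr_sumr /=.
transitivity (\sum_y \sum_v chi v *
    (Phi (sigma (sigma G) * sigma v * y) * Phi (G * v * y))).
  apply: eq_bigr => y _.
  have -> : sigma G * y * ((G + sigma (sigma G)) / sigma G) = y * G + y * sigma (sigma G).
    by rewrite mulrC mulrA mulfVK // mulrC mulrDr.
  have -> : W (sigma G * y) = Phi ((y * sigma (sigma G)) * (sigma y * sigma G)).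
    by rewrite /W exprMn; congr Phi; ring2.
  (* As [chi] is invariant under [sigma], y G may be replaced by its image. The argument of [chi]
     becomes the sum of the two factors inside [Phi], as the braid relation requires. *)
  have -> : chi (y * G + y * sigma (sigma G))
      = chi (y * sigma (sigma G) + sigma y * sigma G).
    by rewrite chiD -(chi_frob i (y * G)) exprMn -chiD addrC.
  rewrite mulNr (mulrA q) -cbrt_sum_braid.
  rewrite (reindex_inj sigma_inj); apply: eq_bigr => v _ /=.
  rewrite chi_frob -[in RHS](cbrt_sum_frob i (G * v * y)) !exprMn.
  by congr (_ * (Phi _ * Phi _)); ring2.
set v0 := (G * sigma G)^-1.
have v00 : v0 != 0 by rewrite invr_eq0 mulf_neq0.
rewrite exchange_big (bigD1 v0) //= [X in _ + X]big1 => [|v vv0]; rewrite -mulr_sumr.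
  rewrite sum_cbrt_sumM ?mulf_neq0 ?expf_neq0 //.
  have -> : sigma (sigma G) * sigma v0 = G * v0.
    rewrite /v0 exprVn exprMn !invfM [LHS]mulrCA mulfV //.
    by rewrite mulr1 mulVKf.
  by rewrite eqxx mulr1 addr0 mulrNN [RHS]mulrA -expr2 mulrC.
have [->|vn0] := eqVneq v 0.
  rewrite big1 ?mulr0 // => y _; by rewrite !(mulr0, mul0r) cbrt_sum0 mulr0.
rewrite sum_cbrt_sumM ?mulf_neq0 ?expf_neq0 //.
case: eqP => [e|_]; last by rewrite !mulr0.
(* Multiplied by sigma G, the equality [e] says that v G sigma G is fixed by sigma. *)
have : v * (G * sigma G) = 0 \/ v * (G * sigma G) = 1.
  apply: sigma_fix; rewrite !exprMn.
  transitivity (sigma (sigma G) * sigma v * sigma G); first by ring2.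
  by rewrite e; ring2.
case=> [/eqP | h]; first by rewrite !mulf_eq0 (negPf vn0) (negPf G0) (negPf sG0).
by case/eqP: vv0; rewrite /v0 -[LHS](mulfK (mulf_neq0 G0 sG0)) h mul1r.
Qed.

Lemma det_neq0 t r : t != 0 -> r != 0 -> t != r -> t * sigma r + r * sigma t != 0.
Proof.
move=> t0 r0 tr; rewrite addF_eq0; apply/eqP => /(sigma_eqM t0)[/eqP | /eqP].
  by rewrite (negPf r0).
by rewrite eq_sym (negPf tr).
Qed.

(* The mixed terms are additive in (t, T), so they cancel over t, r and t + r. *)
Lemma cube_form u v t T : t != 0 -> T != 0 ->
  (T * u + t * v) ^+ 3 * (t * T)^-1
  = u ^+ 3 * (T ^+ 2 / t) + v ^+ 3 * (t ^+ 2 / T) + (u ^+ 2 * v * T + u * v ^+ 2 * t).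
Proof.
move=> t0 T0; apply: (mulIf (mulf_neq0 t0 T0)); rewrite mulfVK ?mulf_neq0 // !mulrDl.
have -> : u ^+ 3 * (T ^+ 2 / t) * (t * T) = u ^+ 3 * T ^+ 3.
  by rewrite -[RHS]mul1r -(mulVf t0); ring2.
have -> : v ^+ 3 * (t ^+ 2 / T) * (t * T) = v ^+ 3 * t ^+ 3.
  by rewrite -[RHS]mul1r -(mulVf T0); ring2.
ring2.
Qed.

(** Over the common denominator t r (t + r) the sum has numerator (t R + r T)^2. *)
Lemma cube_coef_neq0 t r T R : t != 0 -> r != 0 -> t + r != 0 ->
  t * R + r * T != 0 -> T ^+ 2 / t + R ^+ 2 / r + (T + R) ^+ 2 / (t + r) != 0.
Proof.
move=> t0 r0 tr0; apply: contra_neq => h.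
have /eqP : (t * R + r * T) ^+ 2 = 0; last by rewrite expf_eq0 => /eqP.
rewrite -(mul0r (t * r * (t + r))) -h !mulrDl.
have -> : T ^+ 2 / t * (t * r * (t + r)) = T ^+ 2 * r * (t + r).
  by rewrite -[RHS]mul1r -(mulVf t0); ring2.
have -> : R ^+ 2 / r * (t * r * (t + r)) = R ^+ 2 * t * (t + r).
  by rewrite -[RHS]mul1r -(mulVf r0); ring2.
have -> : (T + R) ^+ 2 / (t + r) * (t * r * (t + r)) = (T + R) ^+ 2 * (t * r).
  by rewrite -[RHS]mul1r -(mulVf tr0); ring2.
ring2.
Qed.

Lemma sum_walsh3 t r : t != 0 -> r != 0 -> t != r ->
  \sum_w W (t * w) * (W (r * w) * W ((t + r) * w)) = 0.
Proof.
move=> t0 r0 tr; have tr0 : t + r != 0 by rewrite addF_eq0.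
have sig0 x : x != 0 -> sigma x != 0 by move=> x0; rewrite expf_neq0.
pose g x := cbrt (x * sigma x).
have g_inj : injective g by move=> x y /cbrt_inj/gold_inj.
have g0 x : x != 0 -> g x != 0 by move=> x0; rewrite cbrt_eq0 mulf_neq0 ?sig0.
have WM x w : W (x * w) = S (g x * g w).
  by rewrite /W /Phi /g -cbrtM exprMn; congr (S (cbrt _)); ring2.
under eq_bigr => w _ do rewrite !WM.
rewrite -(reindex_inj g_inj (P := predT)
  (F := fun k => S (g t * k) * (S (g r * k) * S (g (t + r) * k)))) /=.
rewrite sum_cubic_sum3 ?g0 // !cbrtK frobD pair_big /=.
(* Up to the determinant of [det_neq0], [h] inverts the coordinates r x + t y and sigma r x + sigma
   t y. In the new variables x + y has the same shape as x, with t + r in place of t. *)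
pose h (p : F * F) := (sigma t * p.1 + t * p.2, sigma r * p.1 + r * p.2).
have s0 := det_neq0 t0 r0 tr.
have h_inj : injective h.
  move=> [u v] [u' v'] [h1 h2]; congr pair; apply: (mulIf s0).
    transitivity (r * (sigma t * u + t * v) + t * (sigma r * u + r * v)); first by ring2.
    by rewrite h1 h2; ring2.
  transitivity (sigma r * (sigma t * u + t * v) + sigma t * (sigma r * u + r * v)).
    by ring2.
  by rewrite h1 h2; ring2.
rewrite (reindex_inj h_inj) /=.
pose A := sigma t ^+ 2 / t + sigma r ^+ 2 / r + (sigma t + sigma r) ^+ 2 / (t + r).
pose C := t ^+ 2 / sigma t + r ^+ 2 / sigma r + (t + r) ^+ 2 / (sigma t + sigma r).
have A0 : A != 0 by apply: cube_coef_neq0.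
have C0 : C != 0.
  apply: cube_coef_neq0; rewrite -?frobD ?sig0 //.
  by move: s0; rewrite addrC [r * _]mulrC [t * _]mulrC.
transitivity (q * \sum_(p : F * F) chi (p.1 ^+ 3 * A) * chi (p.2 ^+ 3 * C)).
  congr (_ * _); apply: eq_bigr => -[u v] _ /=; rewrite -chiD; congr chi.
  have -> : sigma t * u + t * v + (sigma r * u + r * v)
      = (sigma t + sigma r) * u + (t + r) * v by ring2.
  rewrite !cube_form -?frobD ?sig0 // frobD /A /C; ring2.
rewrite -(pair_big predT predT (fun u v => chi (u ^+ 3 * A) * chi (v ^+ 3 * C))) /=.
by rewrite -big_distrlr /= (sum_chi_cube A0) mul0r mulr0.
Qed.

(** * The Kasami difference map *)

(** By [kasami_exp] the left side is [delta x] for x = u sigma u, so z is its root of exponent 2^i +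
    1. With v = u + c the hypothesis becomes affine in u and sigma u; its images under sigma and
    sigma^2 serve to eliminate sigma u and sigma^2 u. *)
Lemma kasami_identity (u v c : F) : u * sigma u + v * sigma v = 1 -> c = u + v -> c != 0 ->
  let z := (c + sigma (sigma c)) / sigma c in
  u * sigma (sigma (sigma u)) + v * sigma (sigma (sigma v)) + 1 = z * sigma z.
Proof.
move=> uv cE c0 z.
have sig0 x : x != 0 -> sigma x != 0 by move=> x0; rewrite expf_neq0.
have vE : v = u + c by rewrite cE; ring2.
have r01 : u * sigma c + c * sigma u + c * sigma c + 1 = 0.
  by rewrite -[in X in _ + X]uv vE frobD; ring2.
have r12 := congr1 (fun x => sigma x) r01; have r23 := congr1 (fun x => sigma x) r12.
have s00 : sigma 0 = 0 :> F by rewrite expr0n expn_eq0.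
rewrite /= !frobD !exprMn !expr1n !s00 in r12 r23.
apply: (mulIf (mulf_neq0 (sig0 _ c0) (sig0 _ (sig0 _ c0)))).
have -> : z * sigma z * (sigma c * sigma (sigma c))
    = (c + sigma (sigma c)) * (sigma c + sigma (sigma (sigma c))).
  by rewrite mulrACA /z -exprMn mulfVK ?sig0 // frobD.
rewrite vE !frobD; apply/eqP; rewrite -addF_eq0; apply/eqP.
transitivity (sigma (sigma c) * sigma (sigma (sigma c)) * 0
    + c * sigma (sigma (sigma c)) * 0 + c * sigma c * 0); last by ring2.
rewrite -{1}r01 -{1}r12 -{1}r23; ring2.
Qed.

(** Dividing the hypothesis by c sigma c writes 1 / (c sigma c) + 1 as u / c + sigma (u / c), of
    trace zero, whereas 1 has trace one. *)
Lemma kasami_chi (u v c : F) : u * sigma u + v * sigma v = 1 -> c = u + v -> c != 0 ->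
  chi (c * sigma c)^-1 = -1.
Proof.
move=> uv cE c0; have sc0 : sigma c != 0 by rewrite expf_neq0.
have vE : v = u + c by rewrite cE; ring2.
have e : (c * sigma c)^-1 + 1 = u / c + sigma (u / c).
  apply: (mulIf (mulf_neq0 c0 sc0)); rewrite !mulrDl mulVf ?mulf_neq0 // mul1r.
  rewrite expr_div_n mulrA mulfVK // [c * sigma c]mulrC mulrA mulfVK //.
  rewrite -[X in X + _]uv vE frobD; ring2.
have := chiD (c * sigma c)^-1 1; rewrite e chiD chi_frob chiK chi1 mulrN1.
by move=> ->; rewrite opprK.
Qed.

Local Notation d := (inv_exp (2 ^ i + 1) (2 ^ n - 1)).

Lemma gold_rootK x : x ^+ d * sigma (x ^+ d) = x.
Proof.
have e_gt0 : (0 < 2 ^ i + 1)%N by rewrite addn1.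
by rewrite -exprS -[(2 ^ i).+1]addn1 exprAC exp_inv_expK ?coprime_gold.
Qed.

Lemma goldK x : (x * sigma x) ^+ d = x.
Proof. by apply: gold_inj; rewrite /= gold_rootK. Qed.

(** The exponents multiply as (2^i + 1) (2^(2i) - 2^i + 1) = 2^(3i) + 1. *)
Lemma kasami_exp x :
  (x * sigma x) ^+ (2 ^ (2 * i) - 2 ^ i + 1) = x * sigma (sigma (sigma x)).
Proof.
rewrite -!exprM -!exprS -exprM; congr (_ ^+ _).
rewrite mul2n -addnn expnD; case: (2 ^ i)%N (expn_gt0 2 i) => // m _; nia.
Qed.

Definition delta x := (x + 1) ^+ (2 ^ (2 * i) - 2 ^ i + 1) + x ^+ (2 ^ (2 * i) - 2 ^ i + 1) + 1.

(* c = u + v in the substitution x = u^(2^i+1), x + 1 = v^(2^i+1). *)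
Definition step x := x ^+ d + (x + 1) ^+ d.

Lemma root_sum x : x ^+ d * sigma (x ^+ d) + (x + 1) ^+ d * sigma ((x + 1) ^+ d) = 1.
Proof. by rewrite !gold_rootK; ring2. Qed.

Lemma step_neq0 x : step x != 0.
Proof.
rewrite addF_eq0; apply/eqP => e; have := root_sum x.
by rewrite -e addFF => /eqP; rewrite eq_sym oner_eq0.
Qed.

Lemma delta_root x : delta x ^+ d = (step x + sigma (sigma (step x))) / sigma (step x).
Proof.
have := kasami_identity (root_sum x) (erefl (step x)) (step_neq0 x).
rewrite -!kasami_exp !gold_rootK addrC => /= h.
rewrite -[RHS]goldK -h /delta; congr (_ ^+ _); ring2.
Qed.

Lemma step_chi x : chi (step x * sigma (step x))^-1 = -1.
Proof. exact: kasami_chi (root_sum x) (erefl (step x)) (step_neq0 x). Qed.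

(** Both a and b solve sigma^2 c + z sigma c + c = 0 for the same z, so the determinant [D] is fixed
    by sigma and is 0 or 1. [D = 0] means a = b. *)
Lemma kernel_unique a b : a != 0 -> b != 0 -> chi (a * sigma a)^-1 = -1 ->
  (a + sigma (sigma a)) / sigma a = (b + sigma (sigma b)) / sigma b -> a = b.
Proof.
move=> a0 b0 chia ab; have sig0 x : x != 0 -> sigma x != 0 by move=> x0; rewrite expf_neq0.
have abE : (a + sigma (sigma a)) * sigma b = (b + sigma (sigma b)) * sigma a.
  by apply/eqP; rewrite -eqr_div ?sig0 // ab.
pose D := a * sigma b + b * sigma a.
have sD : sigma D = D.
  rewrite /D frobD !exprMn; apply/eqP; rewrite -addF_eq0; apply/eqP.
  transitivity ((a + sigma (sigma a)) * sigma b + (b + sigma (sigma b)) * sigma a).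
    ring2.
  by rewrite abE addFF.
case: (sigma_fix sD) => [/eqP | D1].
  rewrite addF_eq0 => /eqP /(sigma_eqM a0)[/eqP | //].
  by rewrite (negPf b0).
(* D = 1 makes 1 / (a sigma a) of the form w + sigma w, of trace zero *)
have e : (a * sigma a)^-1 = b / a + sigma (b / a).
  apply: (mulIf (mulf_neq0 a0 (sig0 _ a0))); rewrite mulVf ?mulf_neq0 ?sig0 // -D1.
  rewrite mulrDl expr_div_n mulrA mulfVK // [a * sigma a]mulrC mulrA mulfVK ?sig0 //.
  by rewrite /D; ring2.
by move: chia; rewrite e chiD chi_frob chiK.
Qed.

Lemma root_difference u v c : u * sigma u + (u + c) * sigma (u + c) = 1 ->
  v * sigma v + (v + c) * sigma (v + c) = 1 -> c * sigma (u + v) = (u + v) * sigma c.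
Proof.
rewrite !frobD => hu hv; apply/eqP; rewrite -addF_eq0; apply/eqP.
rewrite -[RHS](addFF 1) -{1}hu -hv; ring2.
Qed.

(** By [kernel_unique] the value determines [step x]. Then x^d is determined up to adding [step x],
    which exchanges x^d and (x + 1)^d. *)
Lemma delta_fibre x y : delta x ^+ d = delta y ^+ d -> y = x \/ y = x + 1.
Proof.
rewrite !delta_root => e.
have xy := kernel_unique (step_neq0 x) (step_neq0 y) (step_chi x) e.
have root_inj a b : a ^+ d = b ^+ d -> a = b by move=> ab; rewrite -[a]gold_rootK ab gold_rootK.
have : step x * sigma (x ^+ d + y ^+ d) = (x ^+ d + y ^+ d) * sigma (step x).
  have xE : x ^+ d + step x = (x + 1) ^+ d by rewrite /step; ring2.
  have yE : y ^+ d + step x = (y + 1) ^+ d by rewrite xy /step; ring2.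
  by apply: root_difference; rewrite ?xE ?yE root_sum.
case/(sigma_eqM (step_neq0 x)) => /eqP.
  by rewrite addF_eq0 => /eqP /root_inj; left.
rewrite /step -subr_eq0 opprD addrACA subrr add0r oppF addF_eq0 => /eqP /root_inj.
by right.
Qed.

Definition kasami_image := [set delta x ^+ d | x : F].

Lemma kasami_image_lb : (#|F| <= 2 * #|kasami_image|)%N.
Proof.
rewrite -cardsT -sum1_card (partition_big_imset (fun x => delta x ^+ d)) /=.
have -> : (fun x => delta x ^+ d) @: [set: F] = kasami_image.
  by apply/setP => z; apply/imsetP/imsetP => -[x _ ->]; exists x.
rewrite mulnC -sum_nat_const; apply: leq_sum => z /imsetP[x _ ->].
rewrite sum1_card; apply: (@leq_trans #|[set x; x + 1]|); last by rewrite cards2; case: (_ != _).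
apply/subset_leq_card/subsetP => y; rewrite !inE => /andP[_ /eqP/esym].
by case/delta_fibre => ->; rewrite eqxx ?orbT.
Qed.

(** * Fourier transform of the sign function of the image *)

Definition sgn z : int := if z \in kasami_image then 1 else -1.

Lemma sum_walsh_sqr : \sum_a W a * W a = q ^+ 2.
Proof.
have /eqP := sum_cbrt_sumM (oner_neq0 F) (oner_neq0 F); rewrite eqxx mulr1 => /eqP <-.
rewrite [RHS](reindex_inj gold_inj); apply: eq_bigr => a _ /=.
by rewrite mul1r.
Qed.

Lemma kasami_image_walsh z : z \in kasami_image -> \sum_a chi (a * z) * W a = q.
Proof.
case/imsetP=> x _ ->; rewrite delta_root sum_walsh_kernel ?step_neq0 //.
by rewrite step_chi mulrN1 opprK.
Qed.

Lemma kasami_spectrum :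
  (2 * #|kasami_image|)%N = #|F| /\ forall z, \sum_a chi (a * z) * W a = q * sgn z.
Proof.
pose H z := \sum_a chi (a * z) * W a.
have sumH : \sum_z H z = 0.
  rewrite exchange_big big1 // => a _ /=; rewrite -mulr_suml.
  under eq_bigr => z _ do rewrite mulrC.
  rewrite sum_chi; case: eqP => [->|_]; first by rewrite walsh0 mulr0.
  by rewrite mulr0 mul0r.
have sumH2 : \sum_z H z * H z = q ^+ 3.
  transitivity (\sum_a \sum_b W a * W b * (q * (a + b == 0)%:R)).
    under eq_bigr => z _ do rewrite /H big_distrlr /=.
    rewrite exchange_big; apply: eq_bigr => a _ /=.
    rewrite exchange_big; apply: eq_bigr => b _ /=.
    rewrite -sum_chi mulr_sumr; apply: eq_bigr => z _.
    by rewrite mulrACA -chiD mulrC; congr (_ * chi _); ring2.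
  rewrite [RHS]exprS -sum_walsh_sqr mulr_sumr; apply: eq_bigr => a _.
  rewrite (bigD1 a) //= big1 => [|b ba]; first by rewrite addFF eqxx; lia.
  by rewrite addF_eq0 eq_sym (negPf ba) !mulr0.
(* Parseval: the sum of (H + q)^2 over the complement of the image is 2 q^2 (q - 2 #|image|) *)
have sum2 : \sum_z (H z + q) ^+ 2 = 2 * q ^+ 3.
  transitivity (\sum_z (H z * H z + (2 * q) * H z + q ^+ 2)).
    by apply: eq_bigr => z _; lia.
  rewrite !big_split /= sumH2 -mulr_sumr sumH sumr_const cardT -cardE.
  by rewrite -mulr_natr; lia.
have sumI : \sum_(z in kasami_image) (H z + q) ^+ 2 = 4 * q ^+ 2 * #|kasami_image|%:R.
  rewrite (eq_bigr (fun _ => 4 * q ^+ 2)) => [|z /kasami_image_walsh Hz].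
    by rewrite sumr_const mulr_natr.
  by rewrite /H Hz; lia.
have m_lb : q <= 2 * #|kasami_image|%:R by rewrite -natrM ler_nat kasami_image_lb.
have q_gt0 : 0 < q by rewrite lt_def q_neq0 ler0n.
have ge0 z : 0 <= (H z + q) ^+ 2 by exact: sqr_ge0.
have sumC_ge0 : 0 <= \sum_(z | z \notin kasami_image) (H z + q) ^+ 2 by apply: sumr_ge0.
move: sum2; rewrite (bigID (mem kasami_image)) /= sumI => sum2.
have sumCE : \sum_(z | z \notin kasami_image) (H z + q) ^+ 2
    = 2 * q ^+ 2 * (q - 2 * #|kasami_image|%:R).
  move: sum2; set C := \sum_(z | _) _; move: C (q) (#|_|%:R : int) => C u m.
  clear; rewrite !exprS expr0; nia.
(* The sum in [sumCE] is nonnegative, while [m_lb] makes its value nonpositive. So the image has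
   exactly q / 2 elements and every term of the sum vanishes. *)
have mq : 2 * #|kasami_image|%:R = q.
  apply/eqP; rewrite eq_le m_lb andbT -subr_ge0.
  by move: sumC_ge0; rewrite sumCE pmulr_rge0 // mulr_gt0 ?exprn_gt0.
have sumC0 : \sum_(z | z \notin kasami_image) (H z + q) ^+ 2 = 0.
  by rewrite sumCE mq subrr mulr0.
split; first by apply/eqP; rewrite -(eqr_nat int) natrM mq.
move=> z; rewrite /sgn; case: ifP => [/kasami_image_walsh -> | /negbT zI]; first by rewrite mulr1.
have := psumr_eq0P (fun z _ => ge0 z) sumC0 zI.
by move/eqP; rewrite sqrf_eq0 addr_eq0 mulrN1 => /eqP.
Qed.

(** This locates the zeros of [walsh] for [kasami_translation]. With y = x + p, summing over x
    leaves p^4 = p, hence p = 0 or p = 1. *)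
Lemma cubic_sum_sqr k : S k * S k = q * (1 - chi k).
Proof.
transitivity (\sum_p chi (p ^+ 3 + k * p) * (q * (p + p ^+ 4 == 0)%:R)).
  rewrite big_distrlr /=.
  transitivity (\sum_x \sum_p chi (p ^+ 3 + k * p) * chi (x ^+ 2 * (p + p ^+ 4))).
    apply: eq_bigr => x _; rewrite (reindex_inj (addrI x)) /=.
    apply: eq_bigr => p _; rewrite -!chiD.
    by apply: (@eq_chi (x * p ^+ 2)); ring2.
  rewrite exchange_big; apply: eq_bigr => p _ /=.
  rewrite -mulr_sumr; congr (_ * _).
  by rewrite -sum_chi [RHS](reindex_inj (@frob_inj 1)).
rewrite (bigD1 0) // (bigD1 1) ?oner_eq0 //= big1 => [|p /andP[p0 p1]].
  rewrite !expr0n !expr1n !mulr0 !addr0 addFF eqxx chi0 mulr1 chiD chi1 (mulr1 k).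
  by rewrite -mulrDl mulN1r mulrC.
rewrite addF_eq0; case: eqP => [e | _]; last by rewrite !mulr0.
by case: (frob2_fix (esym e)) p0 p1 => ->; rewrite eqxx.
Qed.

Lemma walsh_sgn a : \sum_z chi (a * z) * sgn z = W a.
Proof.
have [_ spec] := kasami_spectrum.
apply: (mulfI q_neq0); rewrite mulr_sumr.
transitivity (\sum_z \sum_b W b * chi (z * (a + b))).
  apply: eq_bigr => z _; rewrite mulrCA -spec mulr_sumr; apply: eq_bigr => b _.
  by rewrite mulrA mulrC -chiD; congr (_ * chi _); ring2.
rewrite exchange_big /= (bigD1 a) //= [X in _ + X]big1 => [|b ba].
  by rewrite -mulr_sumr sum_chi addFF eqxx mulr1 addr0 mulrC.
by rewrite -mulr_sumr sum_chi addF_eq0 eq_sym (negPf ba) !mulr0.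
Qed.

Lemma sum_sgn : \sum_z sgn z = 0.
Proof.
rewrite -[RHS]walsh0 -[RHS]walsh_sgn; apply: eq_bigr => z _.
by rewrite mul0r chi0 mul1r.
Qed.

(* For a translation by c, the support of W lies in the kernel of chi (_ * c); as
   W a ^ 2 = q (1 - chi (cbrt (a sigma a))), this makes a sum of nonnegative terms vanish
   although the term at 0 is positive. *)
Lemma kasami_translation c :
  (forall z, (z + c \in kasami_image) = (z \in kasami_image)) -> c = 0.
Proof.
move=> per; apply/eqP; apply: contraT => c0.
pose g a := cbrt (a * sigma a).
have g_inj : injective g by move=> x y /cbrt_inj/gold_inj.
(* That is, (1 - chi (g a)) (1 - chi (a c)) = 0: where chi (a c) = -1, the translation forces W a =
   0 and hence chi (g a) = 1. *)
have kill a : chi (g a) + chi (a * c) = 1 + chi (g a) * chi (a * c).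
  have Wc : W a = chi (a * c) * W a.
    rewrite -{1}walsh_sgn (reindex_inj (addIr c)) -(walsh_sgn a) mulr_sumr /=.
    apply: eq_bigr => z _; rewrite [RHS]mulrA -chiD /sgn per.
    by congr (chi _ * _); ring2.
  have := cubic_sum_sqr (g a); rewrite -[S (g a)]/(W a); have := q_neq0.
  case: (chi_pm (a * c)) Wc => -> Wc; first by move=> _ _; rewrite mulr1 addrC.
  have -> : W a = 0 by lia.
  rewrite mul0r => q0 /esym/eqP; rewrite mulf_eq0 (negPf q0) subr_eq0 => /eqP <-.
  by rewrite mul1r.
have sum0 : \sum_a (1 + chi (g a) * chi (a * c)) = 0.
  under eq_bigr => a _ do rewrite -kill.
  rewrite big_split /= sum_chi (negPf c0) mulr0 addr0.
  rewrite -(reindex_inj g_inj (F := fun k => chi k) (P := predT)) /=.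
  transitivity (\sum_k chi (k * 1)); last by rewrite sum_chi oner_eq0 mulr0.
  by apply: eq_bigr => k _; rewrite mulr1.
have ge0 a : 0 <= 1 + chi (g a) * chi (a * c).
  by case: (chi_pm (g a)) => ->; case: (chi_pm (a * c)) => ->.
have := psumr_eq0P (fun a _ => ge0 a) sum0 (isT : predT (0 : F)).
by move/(_ 0); rewrite /g !mul0r cbrt0 chi0.
Qed.

(** * Correlations of the sign function over affine maps, and the affine stabilizer *)

Lemma sum_sgn_pair s0 s1 : s0 != s1 ->
  \sum_a \sum_b sgn (a * s0 + b) * sgn (a * s1 + b) = 0.
Proof.
move=> s01; rewrite pair_big /=.
pose h (p : F * F) := (p.1 * s0 + p.2, p.1 * s1 + p.2).
have s0' : s0 + s1 != 0 by rewrite addF_eq0.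
have h_inj : injective h.
  move=> [a b] [a' b'] [h0 h1].
  have aa : a = a'.
    apply: (mulIf s0'); transitivity (a * s0 + b + (a * s1 + b)); first by ring2.
    by rewrite h0 h1; ring2.
  by congr pair => //; move: h0; rewrite aa => /addrI.
rewrite -(reindex_inj h_inj (F := fun p => sgn p.1 * sgn p.2) (P := predT)) /=.
rewrite -(pair_big predT predT (fun u v => sgn u * sgn v)) /=.
by rewrite -big_distrlr /= sum_sgn mul0r.
Qed.

(** After Fourier expansion the sums over a and b impose u s0 + v s1 + w s2 = 0 and u + v + w = 0.
    The solutions are the multiples of (s1 + s2, s0 + s2, s0 + s1), which leads to [sum_walsh3]. *)
Lemma sum_sgn_triple s0 s1 s2 : s0 != s1 -> s0 != s2 -> s1 != s2 ->
  \sum_a \sum_b sgn (a * s0 + b) * (sgn (a * s1 + b) * sgn (a * s2 + b)) = 0.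
Proof.
move=> s01 s02 s12; have [_ spec] := kasami_spectrum.
have perm3 (x y z x' y' z' : int) :
    x * x' * (y * y' * (z * z')) = x' * (y' * z') * (x * (y * z)).
  by lia.
have q3 : q * (q * q) != 0 by rewrite !mulf_neq0 ?q_neq0.
apply: (mulfI q3); rewrite mulr0 mulr_sumr.
transitivity (\sum_a \sum_b \sum_u \sum_v \sum_w
    (W u * (W v * W w)) * (chi (a * (u * s0 + v * s1 + w * s2)) * chi (b * (u + v + w)))).
  apply: eq_bigr => a _; rewrite mulr_sumr; apply: eq_bigr => b _.
  rewrite mulrACA [q * q * _]mulrACA -!spec mulr_suml; apply: eq_bigr => u _.
  rewrite big_distrlr mulr_sumr; apply: eq_bigr => v _ /=.
  rewrite mulr_sumr; apply: eq_bigr => w _.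
  rewrite perm3 -!chiD; congr (_ * chi _); ring2.
transitivity (\sum_u \sum_v \sum_w (W u * (W v * W w)) *
   ((q * (u * s0 + v * s1 + w * s2 == 0)%:R) * (q * (u + v + w == 0)%:R))).
  transitivity (\sum_u \sum_v \sum_w \sum_a \sum_b
    (W u * (W v * W w)) * (chi (a * (u * s0 + v * s1 + w * s2)) * chi (b * (u + v + w)))).
    under eq_bigr => a _ do rewrite exchange_big /=.
    rewrite exchange_big; apply: eq_bigr => u _ /=.
    under eq_bigr => a _ do rewrite exchange_big /=.
    rewrite exchange_big; apply: eq_bigr => v _ /=.
    under eq_bigr => a _ do rewrite exchange_big /=.
    by rewrite exchange_big; apply: eq_bigr => w _ /=.
  apply: eq_bigr => u _; apply: eq_bigr => v _; apply: eq_bigr => w _.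
  move: (W u * (W v * W w)) => k.
  by rewrite -!sum_chi big_distrlr /= mulr_sumr; apply: eq_bigr => a _; rewrite mulr_sumr.
pose t := s1 + s2; pose r := s0 + s2.
have t0 : t != 0 by rewrite addF_eq0.
have r0 : r != 0 by rewrite addF_eq0.
have tr : t != r by rewrite -subr_eq0 opprD addrACA subrr addr0 oppF addF_eq0 eq_sym.
transitivity (q * q * \sum_w W (t * w) * (W (r * w) * W ((t + r) * w))); last first.
  by rewrite sum_walsh3 ?mulr0.
rewrite (reindex_inj (mulfI t0)) mulr_sumr; apply: eq_bigr => u _ /=.
rewrite (reindex_inj (mulfI r0)) (bigD1 u) //= [X in _ + X]big1 => [|v vu].
  rewrite addr0 (bigD1 ((t + r) * u)) //= [X in _ + X]big1 => [|w wu].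
    have -> : t * u * s0 + r * u * s1 + (t + r) * u * s2 = 0 by rewrite /t /r; ring2.
    have -> : t * u + r * u + (t + r) * u = 0 by ring2.
    by rewrite eqxx !mulr1 addr0 mulrC.
  by rewrite -(mulrDl t r u) [_ + w == 0]addF_eq0 [_ == w]eq_sym (negPf wu) !mulr0.
apply: big1 => w _; case: eqP => [e1|_]; last by rewrite mulr0 mul0r mulr0.
case: eqP => [e2|_]; last by rewrite !mulr0.
have wE : w = t * u + r * v by apply/eqP; rewrite -addF_eq0 addrC e2.
have /eqP : t * r * (u + v) = 0 by rewrite -e1 wE /t /r; ring2.
by rewrite !mulf_eq0 (negPf t0) (negPf r0) addF_eq0 eq_sym (negPf vu).
Qed.

(* If a <> 1, the map fixes some c, and comparing the product of z over the z <> 0 with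
   z + c in the set before and after z |-> a z gives a^m = 1, with 2 m equal to q or q - 2. *)
Lemma kasami_affine_stab a b : a != 0 ->
  (forall z, (a * z + b \in kasami_image) = (z \in kasami_image)) -> a = 1 /\ b = 0.
Proof.
move=> a0 stab; suff a1 : a = 1.
  split=> //; apply: kasami_translation => z; rewrite -[RHS]stab.
  by rewrite a1 mul1r.
apply/eqP; apply: contraT => a_neq1.
have a1' : 1 + a != 0 by rewrite addF_eq0 eq_sym.
pose c := b / (1 + a).
have bE : b = c + a * c by rewrite -[X in X + _]mul1r -mulrDl mulrC mulfVK.
pose Y := [set z | z + c \in kasami_image].
have cardY : #|Y| = #|kasami_image|.
  rewrite -(card_imset (mem Y) (addIr c)); congr #|pred_of_set _|.
  apply/setP => z; apply/imsetP/idP => [[y + ->]|zI]; first by rewrite inE.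
  by exists (z + c); rewrite ?inE -addrA addFF addr0.
have aY z : (a * z \in Y :\ 0) = (z \in Y :\ 0).
  rewrite !inE mulf_eq0 (negPf a0) /=; rewrite -[in RHS]stab.
  by have -> : a * (z + c) + b = a * z + c by rewrite bE; ring2.
have prod_neq0 : \prod_(z in Y :\ 0) z != 0.
  by apply/prodf_neq0 => z; rewrite !inE => /andP[].
have aX : a ^+ #|Y :\ 0| = 1.
  apply: (mulIf prod_neq0); rewrite mul1r -prodr_const -big_split /=.
  rewrite [RHS](reindex_inj (mulfI a0)) /=; apply: eq_bigl => z.
  by rewrite aY.
have [half _] := kasami_spectrum.
move: half; rewrite -cardY (cardsD1 0) mulnDr => half.
have aq : a = a ^+ (2 * (0 \in Y)).
  have := expf_card a; rewrite -half exprD [(2 * #|_|)%N]mulnC [a ^+ (_ * 2)]exprM aX.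
  by rewrite expr1n mulr1 => ->.
case/eqP: a_neq1; move: aq; case: (0 \in Y) => /= aq; last by rewrite muln0 in aq.
by apply: (mulfI a0); rewrite mulr1 [RHS]aq.
Qed.

(** * The design *)

Definition block (p : F * F) := [set p.1 * x + p.2 | x in ~: kasami_image].

Lemma affine_inj a b : a != 0 -> injective (fun x => a * x + b).
Proof. by move=> a0 x y /addIr/(mulfI a0). Qed.

Lemma mem_block p x : p.1 != 0 -> (p.1 * x + p.2 \in block p) = (x \notin kasami_image).
Proof. by move=> p0; rewrite (mem_imset _ _ (affine_inj (b := p.2) p0)) inE. Qed.

Lemma card_block p : p.1 != 0 -> #|block p| = (2 ^ n %/ 2)%N.
Proof.
move=> p0; rewrite card_imset; last exact: affine_inj.
have [half _] := kasami_spectrum.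
have := cardsC kasami_image; rewrite -cardF -half mul2n -addnn => /addnI ->.
by rewrite addnn -muln2 mulnK.
Qed.

(** Equal blocks yield an affine map preserving the image, trivial by [kasami_affine_stab]. Hence
    blocks can be counted by pairs (a, b). *)
Lemma block_inj : {in [set p : F * F | p.1 != 0] &, injective block}.
Proof.
move=> [a b] [a' b']; rewrite !inE /= => a0 a0' e.
have aE x : a * x + b = a' * (a / a' * x + (b + b') / a') + b'.
  rewrite mulrDr !mulrA [a' * a]mulrC mulfK // [a' * (b + b')]mulrC mulfK //.
  by rewrite -!addrA addFF addr0.
have stab x : (a / a' * x + (b + b') / a' \in kasami_image) = (x \in kasami_image).
  apply: negb_inj; rewrite -(@mem_block (a', b') (a / a' * x + (b + b') / a') a0') -e /= -aE.
  exact: (@mem_block (a, b) x a0).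
have [|/eqP aa /eqP] := kasami_affine_stab _ stab.
  by rewrite mulf_neq0 ?invr_eq0.
rewrite mulf_eq0 invr_eq0 (negPf a0') orbF addF_eq0 => /eqP ->.
by move: aa; rewrite -(inj_eq (mulIf a0')) mulfVK // mul1r => /eqP ->.
Qed.

Lemma sgn_indicator z : 2 * (z \notin kasami_image)%:R = 1 - sgn z.
Proof. by rewrite /sgn; case: (z \in _). Qed.

Lemma sum_sgn_affine a : \sum_b sgn (a + b) = 0.
Proof. by rewrite -[RHS]sum_sgn [RHS](reindex_inj (addrI a)). Qed.

(** Only the constant term of the expanded product survives; the single, pair and triple
    correlations all vanish. *)
Lemma sum_indicator_triple s0 s1 s2 : s0 != s1 -> s0 != s2 -> s1 != s2 ->
  \sum_(p : F * F) (1 - sgn (p.1 * s0 + p.2)) * (1 - sgn (p.1 * s1 + p.2))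
    * (1 - sgn (p.1 * s2 + p.2)) = q ^+ 2.
Proof.
move=> s01 s02 s12.
have E1 x : \sum_(p : F * F) sgn (p.1 * x + p.2) = 0.
  rewrite -(pair_big predT predT (fun a b => sgn (a * x + b))) /=.
  by rewrite big1 // => a _; rewrite sum_sgn_affine.
have E2 x y : x != y -> \sum_(p : F * F) sgn (p.1 * x + p.2) * sgn (p.1 * y + p.2) = 0.
  move=> xy; rewrite -(pair_big predT predT (fun a b => sgn (a * x + b) * sgn (a * y + b))) /=.
  exact: sum_sgn_pair.
have E3 : \sum_(p : F * F) sgn (p.1 * s0 + p.2)
    * (sgn (p.1 * s1 + p.2) * sgn (p.1 * s2 + p.2)) = 0.
  rewrite -(pair_big predT predT
    (fun a b => sgn (a * s0 + b) * (sgn (a * s1 + b) * sgn (a * s2 + b)))) /=.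
  exact: sum_sgn_triple.
transitivity (\sum_(p : F * F) (1 - (sgn (p.1 * s0 + p.2) + sgn (p.1 * s1 + p.2)
    + sgn (p.1 * s2 + p.2)) + (sgn (p.1 * s0 + p.2) * sgn (p.1 * s1 + p.2)
    + sgn (p.1 * s0 + p.2) * sgn (p.1 * s2 + p.2)
    + sgn (p.1 * s1 + p.2) * sgn (p.1 * s2 + p.2))
    - sgn (p.1 * s0 + p.2) * (sgn (p.1 * s1 + p.2) * sgn (p.1 * s2 + p.2)))).
  apply: eq_bigr => p _.
  move: (sgn (p.1 * s0 + p.2)) (sgn (p.1 * s1 + p.2)) (sgn (p.1 * s2 + p.2)) => x y z.
  by lia.
rewrite !(big_split, sumrN) /= !E1 !E2 // E3 sumr_const card_prod natrM.
by rewrite !(addr0, oppr0) expr2.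
Qed.

(** Each membership indicator is half of some 1 - sgn, whence the factor 8. Replacing a by its
    inverse and rescaling b makes the arguments a s + b; the subtracted 4 q is the contribution of a
    = 0. *)
Lemma card_blocks_through s0 s1 s2 : s0 != s1 -> s0 != s2 -> s1 != s2 ->
  (8 * #|[set p | (p.1 != 0) && [&& s0 \in block p, s1 \in block p & s2 \in block p]]|%:R
   = q ^+ 2 - 4 * q)%R.
Proof.
move=> s01 s02 s12.
have memE s p : p.1 != 0 -> (s \in block p) = ((s + p.2) / p.1 \notin kasami_image).
  move=> p0; rewrite -(mem_block _ p0) mulrC mulfVK //.
  by rewrite -addrA addFF addr0.
rewrite -sum1_card natr_sum mulr_sumr.
transitivity (\sum_(p : F * F | p.1 != 0) (1 - sgn ((s0 + p.2) / p.1))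
    * (1 - sgn ((s1 + p.2) / p.1)) * (1 - sgn ((s2 + p.2) / p.1))).
  rewrite big_mkcond [RHS]big_mkcond; apply: eq_bigr => p _; rewrite inE.
  have [//|p0] := eqVneq p.1 0; rewrite /= !memE // -!sgn_indicator.
  by case: (_ \in _) => //; case: (_ \in _) => //; case: (_ \in _).
pose G a b := (1 - sgn (a * s0 + b)) * (1 - sgn (a * s1 + b)) * (1 - sgn (a * s2 + b)).
transitivity (\sum_(a | a != 0) \sum_b G a b).
  rewrite (eq_bigl (fun p => (p.1 != 0) && predT p.2)) => [|p]; last by rewrite andbT.
  rewrite -(pair_big (fun a => a != 0) predT (fun a b => (1 - sgn ((s0 + b) / a))
    * (1 - sgn ((s1 + b) / a)) * (1 - sgn ((s2 + b) / a)))) /=.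
  rewrite (reindex_inj invr_inj) /=; apply: eq_big => a; first by rewrite invr_eq0.
  rewrite invr_eq0 => a0; rewrite [RHS](reindex_inj (mulfI a0)); apply: eq_bigr => b _ /=.
  by rewrite /G invrK -!mulrDr ![a * (_ + b)]mulrC.
have : \sum_a \sum_b G a b = q ^+ 2.
  rewrite pair_big; exact: sum_indicator_triple.
rewrite (bigD1 0) //= => <-; rewrite addrC -addrA [X in _ = _ + X](_ : _ = 0) ?addr0 //.
apply/eqP; rewrite subr_eq0; apply/eqP.
(* As 1 - sgn b is 0 or 2, its cube is 4 times itself. *)
transitivity (\sum_b 4 * (1 - sgn b)).
  apply: eq_bigr => b _; rewrite /G !mul0r !add0r /sgn.
  by case: ifP.
by rewrite -mulr_sumr big_split /= sumrN sum_sgn oppr0 addr0 sumr_const.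
Qed.

End Gold.

End Kasami.

Theorem theorem12 (n i : nat) (F : finFieldType) :
  odd n -> #|F| = (2 ^ n)%N -> (0 < i)%N -> coprime i n ->
  let q := (2 ^ n)%N in
  let s := (2 ^ (2 * i) - 2 ^ i + 1)%N in
  let d := inv_exp (2 ^ i + 1) (q - 1) in
  let B : {set F} :=
    ~: [set (((x + 1) ^+ s + x ^+ s + 1) ^+ d) | x : F] in
  is_3_design (GA1_orbit B) q (q %/ 2) (q * (q - 4) %/ 8).
Proof.
move=> odd_n cardF _ co_in q s d B; pose blk := @block F n i.
have orbitE : GA1_orbit B = [set blk p | p in [set p : F * F | p.1 != 0]] by [].
split=> //.
  by move=> Bl; rewrite orbitE => /imsetP[p + ->]; rewrite inE; apply: card_block.
move=> S S3.
have [s0 [s1 [s2 [s01 s02 s12 SE]]]] : exists s0 s1 s2 : F,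
    [/\ s0 != s1, s0 != s2, s1 != s2 & S =i [:: s0; s1; s2]].
  move: S3 (enum_uniq (mem S)) (mem_enum (mem S)); rewrite cardE.
  case: (enum _) => [|s0 [|s1 [|s2 []]]] // _ /=.
  rewrite !inE !negb_or andbT => /andP[/andP[s01 s02] s12] SE.
  by exists s0, s1, s2; split=> // x; rewrite -SE.
have subE p : (S \subset blk p) = [&& s0 \in blk p, s1 \in blk p & s2 \in blk p].
  apply/subsetP/and3P => [sub | [p0 p1 p2] x];
    first by split; apply: sub; rewrite SE !inE eqxx ?orbT.
  by rewrite SE !inE => /or3P[] /eqP ->.
have -> : [set Bl in GA1_orbit B | S \subset Bl] = [set blk p | p in
    [set p | (p.1 != 0) && [&& s0 \in blk p, s1 \in blk p & s2 \in blk p]]].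
  apply/setP => Bl; rewrite inE orbitE; apply/andP/imsetP => [[] | [p]].
    case/imsetP => p; rewrite inE => p0 -> sub; exists p => //.
    by rewrite inE p0 -subE.
  by rewrite inE -subE => /andP[p0 sub] ->; split=> //; apply: imset_f; rewrite inE.
rewrite card_in_imset; last first.
  move=> p p'; rewrite !inE => /andP[p0 _] /andP[p0' _].
  by apply: (block_inj odd_n cardF co_in); rewrite inE.
have := card_blocks_through odd_n cardF co_in s01 s02 s12.
rewrite cardF -/q; set N := #|_| => N8.
(* The subtraction in q - 4 is truncated; the three points of [S] exclude q = 2. *)
have q4 : (4 <= q)%N.
  have : (3 <= q)%N by rewrite -S3 /q -cardF max_card.
  by rewrite /q; case: (n) odd_n => [|[|m]] // _ _; rewrite !expnS mulnA leq_pmulr ?expn_gt0.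
have -> : (q * (q - 4) = N * 8)%N by move: N8 q4; nia.
by rewrite mulnK.
Qed.
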